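(* Let $\mathcal{D}=\{(\mathbf{x}_1,y_1),\ldots,(\mathbf{x}_n,y_n)\}$ with $n\ge 2$, $\mathbf{x}_i\in\mathbb{R}^d$, and let $\mathcal{D}'=\mathcal{D}\setminus\{(\mathbf{x}_n,y_n)\}$. Let $\ell(\mathbf{w}^\top\mathbf{x},y)$ be a convex loss, differentiable everywhere and twice differentiable in its first argument, and let $\lambda>0$. Define $$L(\mathbf{w};\mathcal{D})=\sum_{i=1}^n \ell(\mathbf{w}^\top\mathbf{x}_i,y_i)+\frac{\lambda n}{2}\|\mathbf{w}\|_2^2,\qquad L(\mathbf{w};\mathcal{D}')=\sum_{i=1}^{n-1} \ell(\mathbf{w}^\top\mathbf{x}_i,y_i)+\frac{\lambda (n-1)}{2}\|\mathbf{w}\|_2^2,$$ let $\mathbf{w}^*=\arg\min_{\mathbf{w}} L(\mathbf{w};\mathcal{D})$, $\Delta=\lambda\mathbf{w}^*+\nabla\ell((\mathbf{w}^* )^\top\mathbf{x}_n,y_n)$, $H_{\mathbf{w}}=\nabla^2 L(\mathbf{w};\mathcal{D}')$, and $\mathbf{w}^-=\mathbf{w}^*+H_{\mathbf{w}^*}^{-1}\Delta$. Suppose that for all $(\mathbf{x}_i,y_i)\in\mathcal{D}$ and all $\mathbf{w}\in\mathbb{R}^d$, $\|\nabla\ell(\mathbf{w}^\top\mathbf{x}_i,y_i)\|_2\le C$; suppose also that $\ell''$ is $\gamma$-Lipschitz and $\|\mathbf{x}_i\|_2\le 1$ for all $(\mathbf{x}_i,y_i)\in\mathcal{D}$. Then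 $$\|\nabla L(\mathbf{w}^-;\mathcal{D}')\|_2=\|(H_{\mathbf{w}_\eta}-H_{\mathbf{w}^*})H_{\mathbf{w}^*}^{-1}\Delta\|_2\le \gamma(n-1)\|H_{\mathbf{w}^*}^{-1}\Delta\|_2^2\le\frac{4\gamma C^2}{\lambda^2(n-1)},$$ where $H_{\mathbf{w}_\eta}$ is the Hessian of $L(\cdot;\mathcal{D}')$ at $\mathbf{w}_\eta=\mathbf{w}^*+\eta H_{\mathbf{w}^*}^{-1}\Delta$ for some $\eta\in[0,1]$.
   Context: Gradients $\nabla\ell(\mathbf{w}^\top\mathbf{x},y)$ and Hessians are taken with respect to $\mathbf{w}$; $\ell''$ denotes the second derivative of $\ell$ with respect to its first (scalar) argument. $\mathbf{w}^-$ is called the Newton update removal of the point $(\mathbf{x}_n,y_n)$. *)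

(* Defs.v *)
From HB Require Import structures.
From mathcomp Require Import all_boot all_order all_algebra.
From mathcomp Require Import all_classical all_reals all_analysis.
Set Implicit Arguments. Unset Strict Implicit. Unset Printing Implicit Defensive.
Import Order.TTheory GRing.Theory Num.Theory.
Import numFieldNormedType.Exports.
Local Open Scope ring_scope.

Section Defs.
Variable R : realType.
Variable d : nat.

Definition dotv (u v : 'cV[R]_d) : R := \sum_(j < d) u j 0 * v j 0.
Definition norm2 (v : 'cV[R]_d) : R := Num.sqrt (\sum_(j < d) v j 0 ^+ 2).

Definition evec (j : 'I_d) : 'cV[R]_d := delta_mx j 0.

Definition grad (f : 'cV[R]_d -> R) (w : 'cV[R]_d) : 'cV[R]_d :=
  \col_(j < d) ('D_(evec j) f w).

Definition hess (f : 'cV[R]_d -> R) (w : 'cV[R]_d) : 'M[R]_d :=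
  \matrix_(j < d, k < d) ('D_(evec k) (fun u => grad f u j 0) w).
End Defs.

Definition dl (R : realType) (Y : Type) (l : R -> Y -> R) (y : Y) (z : R) : R :=
  derive1 (fun t => l t y) z.
Definition d2l (R : realType) (Y : Type) (l : R -> Y -> R) (y : Y) (z : R) : R :=
  derive1 (dl l y) z.

Definition Lemp (R : realType) (d : nat) (Y : Type) (l : R -> Y -> R)
  (lam : R) (x : nat -> 'cV[R]_d) (y : nat -> Y) (m : nat) (w : 'cV[R]_d) : R :=
  \sum_(i < m) l (dotv w (x i)) (y i) + lam * m%:R / 2 * norm2 w ^+ 2.

(* Main.v *)
Require Import Defs.
From HB Require Import structures.
From mathcomp Require Import all_boot all_order all_algebra.
From mathcomp Require Import all_classical all_reals all_analysis.
From mathcomp Require Import ring lra.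
Set Implicit Arguments. Unset Strict Implicit. Unset Printing Implicit Defensive.
Import Order.TTheory GRing.Theory Num.Theory.
Import numFieldNormedType.Exports.
Local Open Scope ring_scope.

(* Since the gradient of L(.;D) vanishes at w*, we have Delta = - grad L(w*;D'), so
   grad L(w^-;D') is the first-order Taylor remainder of grad L(.;D') along v.
   The vector-valued mean value theorem holds only as an inequality, but an
   equality of norms is enough here: pairing with the remainder G itself gives
   |G| <= |(H_xi - H_{w*}) v| for some xi in [0, 1], and since
   t |-> |(H_t - H_{w*}) v| is continuous and vanishes at t = 0, it takes the
   value |G| at some eta <= xi.  Convexity makes H_{w*} >= lam (n-1) I, and the
   stationarity of w* bounds lam |w*| by C, whence |v| <= 2 C / (lam (n-1)). *)

(** * Euclidean inner product and norm on column vectors *)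

Section EuclideanNorm.
Variables (R : realType) (d : nat).
Implicit Types (u v w : 'cV[R]_d) (a b : R).

Lemma dotvC u v : dotv u v = dotv v u.
Proof. by apply: eq_bigr => j _; rewrite mulrC. Qed.

Lemma dotvDl u v w : dotv (u + v) w = dotv u w + dotv v w.
Proof. by rewrite /dotv -big_split; apply: eq_bigr => j _; rewrite mxE mulrDl. Qed.

Lemma dotvZl a u v : dotv (a *: u) v = a * dotv u v.
Proof. by rewrite /dotv mulr_sumr; apply: eq_bigr => j _; rewrite mxE mulrA. Qed.

Lemma dotvDr u v w : dotv w (u + v) = dotv w u + dotv w v.
Proof. by rewrite dotvC dotvDl !(dotvC w). Qed.

Lemma dotvZr a u v : dotv u (a *: v) = a * dotv u v.
Proof. by rewrite dotvC dotvZl dotvC. Qed.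

Lemma dotvBl u v w : dotv (u - v) w = dotv u w - dotv v w.
Proof. by rewrite dotvDl -scaleN1r dotvZl mulN1r. Qed.

Lemma dotv0l v : dotv 0 v = 0.
Proof. by rewrite -(scale0r 0) dotvZl mul0r. Qed.

Lemma dotv_suml m (u : 'I_m -> 'cV[R]_d) v :
  dotv (\sum_i u i) v = \sum_i dotv (u i) v.
Proof.
apply: (big_ind2 (fun s t => dotv s v = t)) => [|s s' t t' <- <-|//].
  exact: dotv0l.
exact: dotvDl.
Qed.

Lemma dotv_evec v j : dotv v (evec R j) = v j 0.
Proof.
rewrite /dotv (bigD1 j) //= !mxE !eqxx mulr1 big1 ?addr0 // => k /negPf kj.
by rewrite !mxE kj mulr0.
Qed.

Lemma dotvv_ge0 v : 0 <= dotv v v.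
Proof. by apply: sumr_ge0 => j _; rewrite -expr2 sqr_ge0. Qed.

Lemma norm2E v : norm2 v = Num.sqrt (dotv v v).
Proof. by congr Num.sqrt; apply: eq_bigr => j _; rewrite expr2. Qed.

Lemma sqr_norm2 v : norm2 v ^+ 2 = dotv v v.
Proof. by rewrite norm2E sqr_sqrtr ?dotvv_ge0. Qed.

Lemma norm2_ge0 v : 0 <= norm2 v.
Proof. by rewrite norm2E sqrtr_ge0. Qed.

Lemma norm2_eq0 v : norm2 v = 0 -> v = 0.
Proof.
move=> nv; have: dotv v v == 0 by rewrite -sqr_norm2 nv expr0n.
rewrite /dotv psumr_eq0 => [/allP v0|j _]; last by rewrite -expr2 sqr_ge0.
apply/colP => j; rewrite mxE.
by have := v0 j; rewrite mem_index_enum mulf_eq0 orbb => /(_ isT)/eqP.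
Qed.

Lemma norm2_0 : norm2 (0 : 'cV[R]_d) = 0.
Proof. by rewrite norm2E dotv0l sqrtr0. Qed.

Lemma norm2Z a v : norm2 (a *: v) = `|a| * norm2 v.
Proof.
by rewrite !norm2E dotvZl dotvZr mulrA -expr2 sqrtrM ?sqr_ge0// sqrtr_sqr.
Qed.

Lemma norm2N v : norm2 (- v) = norm2 v.
Proof. by rewrite -scaleN1r norm2Z normrN1 mul1r. Qed.

(** Cauchy-Schwarz: the squared norm of [dotv v v *: u - dotv u v *: v] is nonnegative and factors
    as [dotv v v] times the Gram determinant of [u] and [v]. *)
Lemma dotv_le_norm2 u v : `|dotv u v| <= norm2 u * norm2 v.
Proof.
have [v0|vn0] := eqVneq (norm2 v) 0.
  by rewrite (norm2_eq0 v0) dotvC dotv0l normr0 norm2_0 mulr0.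
have v_gt0 : 0 < dotv v v by rewrite -sqr_norm2 exprn_gt0// lt0r vn0 norm2_ge0.
rewrite -[leLHS]ger0_norm// -ler_sqr ?nnegrE ?mulr_ge0 ?norm2_ge0//.
rewrite ger0_norm// real_normK ?num_real// exprMn !sqr_norm2.
have := dotvv_ge0 (dotv v v *: u + (- dotv u v) *: v).
rewrite !(dotvDl, dotvDr, dotvZl, dotvZr) (dotvC v u) => h.
have {h} : 0 <= dotv v v * (dotv u u * dotv v v - dotv u v ^+ 2) by lra.
by rewrite pmulr_rge0// subr_ge0.
Qed.

Lemma norm2D u v : norm2 (u + v) <= norm2 u + norm2 v.
Proof.
rewrite -ler_sqr ?nnegrE ?addr_ge0 ?norm2_ge0//.
rewrite sqrrD !sqr_norm2 dotvDl !dotvDr (dotvC v u).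
have := le_trans (ler_norm _) (dotv_le_norm2 u v); lra.
Qed.

Lemma norm2_sum m (u : 'I_m -> 'cV[R]_d) : norm2 (\sum_i u i) <= \sum_i norm2 (u i).
Proof.
apply: (big_ind2 (fun s t => norm2 s <= t)) => [|s t s' t' st st'|//].
  by rewrite norm2_0.
exact: le_trans (norm2D _ _) (lerD st st').
Qed.

Lemma norm2_dist u v : `|norm2 u - norm2 v| <= norm2 (u - v).
Proof.
have := norm2D (u - v) v; have := norm2D (v - u) u.
by rewrite !subrK -(opprB u v) norm2N ler_norml => h1 h2; apply/andP; split; lra.
Qed.

End EuclideanNorm.

(** * One-variable calculus and convexity *)

Section ScalarCalculus.
Variable R : realType.

Lemma lipschitz_continuous (f : R -> R) (K : R) :
  (forall s t, `|f s - f t| <= K * `|s - t|) -> continuous f.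
Proof.
move=> fK s; apply/cvgrPdist_le => e e0.
(* Adding 1 makes the constant positive, so that it can divide [e] even if [K] is zero or
   negative. *)
have K1 : 0 < `|K| + 1 by rewrite ltr_pwDr.
near=> t; apply: le_trans (fK s t) _.
apply: (@le_trans _ _ ((`|K| + 1) * `|s - t|)).
  by rewrite ler_wpM2r// ler_wpDr// ler_norm.
rewrite mulrC -ler_pdivlMr//.
near: t.
by apply: (@cvgr_dist_le _ _ _ _ _ id) => //; rewrite divr_gt0.
Unshelve. all: by end_near. Qed.

Lemma is_derive_affine_comp (f : R -> R) (c a t : R) :
  derivable f (c + t * a) 1 ->
  is_derive t 1 (fun s => f (c + s * a)) (a * f^`()%classic (c + t * a)).
Proof.
move=> df.
have dg : is_derive t 1 (fun s : R => c + s * a) a.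
  have -> : (fun s : R => c + s * a) = cst c + a \*: id.
    by apply/funext => s /=; rewrite mulrC.
  by apply: is_derive_eq; rewrite add0r [_ *: _]mulr1.
have df' : is_derive (c + t * a) 1 f (f^`()%classic (c + t * a)).
  by apply: DeriveDef => //; rewrite derive1E.
by rewrite mulrC; exact: (@is_derive1_comp R f (fun s => c + s * a) t _ _ df' dg).
Qed.

(** By convexity each quotient [(f (a + h * (b - a)) - f a) / h] with [0 < h <= 1] is at most
    [f b - f a]; let [h] tend to 0 from the right. *)
Lemma convex_tangent (f : R -> R) (a b : R) :
  (forall s, 0 <= s <= 1 -> f (s * b + (1 - s) * a) <= s * f b + (1 - s) * f a) ->
  derivable f a 1 -> (b - a) * f^`()%classic a <= f b - f a.
Proof.
move=> cvx df.
have df0 : derivable f (a + 0 * (b - a)) 1 by rewrite mul0r addr0.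
have [dg] := is_derive_affine_comp df0.
rewrite mul0r addr0 => <-.
have {}dg := cvg_dnbhs_at_right dg.
rewrite /derive -(cvg_lim (@Rhausdorff R) dg).
apply: limr_le; first exact: cvgP dg.
near=> h.
have h0 : 0 < h by [].
have h1 : h <= 1 by near: h; exact: nbhs_right_le.
rewrite /= addr0 mul0r addr0 [_%:A]mulr1 [_ *: _]mulrC ler_pdivrMr//.
have := cvx h; rewrite (ltW h0) h1 => /(_ isT).
have -> : h * b + (1 - h) * a = a + h * (b - a) by ring.
lra.
Unshelve. all: by end_near. Qed.

Lemma derive1_nondecreasing_ge0 (f : R -> R) (a : R) :
  {homo f : s t / s <= t} -> derivable f a 1 -> 0 <= f^`()%classic a.
Proof.
move=> fi df; rewrite derive1E; apply: limr_ge => //.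
near=> h; rewrite /= [_%:A]mulr1.
have [h0|h0|->] := ltgtP h 0.
- by apply: mulr_le0; rewrite ?invr_le0 ?(ltW h0)// subr_le0 fi// gerDr ltW.
- by apply: mulr_ge0; rewrite ?invr_ge0 ?(ltW h0)// subr_ge0 fi// lerDr ltW.
(* At [h = 0] the quotient is 0 by the convention [0^-1 = 0]. *)
- by rewrite invr0 scale0r.
Unshelve. all: by end_near. Qed.

(** Adding the tangent inequalities at [s] and at [t] shows that the first derivative is
    nondecreasing. *)
Lemma convex_derive2_ge0 (f : R -> R) (z : R) :
  (forall a b s, 0 <= s <= 1 ->
     f (s * a + (1 - s) * b) <= s * f a + (1 - s) * f b) ->
  (forall a, derivable f a 1) -> derivable f^`()%classic z 1 ->
  0 <= f^`()^`()%classic z.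
Proof.
move=> cvx df; apply: derive1_nondecreasing_ge0 => s t; rewrite le_eqVlt.
case/predU1P => [->//|st].
have h1 := convex_tangent (cvx t s) (df s).
have h2 := convex_tangent (cvx s t) (df t).
have : 0 <= (t - s) * (f^`()%classic t - f^`()%classic s) by lra.
by rewrite pmulr_rge0 ?subr_gt0// subr_ge0.
Qed.

End ScalarCalculus.

(** Both derivatives are limits of the same quotient. This brings one-variable theorems (Fermat,
    mean value) to functions of vectors. *)
Lemma is_derive_line (R : realType) (V : normedModType R) (f : V -> R) (w v : V)
    (t df : R) :
  is_derive (w + t *: v) v f df -> is_derive t 1 (fun s => f (w + s *: v)) df.
Proof.
have qE : (fun h : R => h^-1 *: (f (w + (h *: 1 + t) *: v) - f (w + t *: v))) =
          (fun h => h^-1 *: (f (h *: v + (w + t *: v)) - f (w + t *: v))).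
  apply/funext => h; rewrite [h *: 1]mulr1 scalerDl.
  by rewrite addrCA.
by move=> [dg <-]; split; rewrite /derivable /derive /= qE.
Qed.

(** * Gradient and Hessian of the regularised loss *)

Section Ridge.
Variables (R : realType) (d : nat) (Y : Type).
Variables (l : R -> Y -> R) (lam : R) (x : nat -> 'cV[R]_d) (y : nat -> Y).
Hypothesis dl1 : forall yy z, derivable (fun t => l t yy) z 1.
Hypothesis dl2 : forall yy z, derivable (dl l yy) z 1.

(** On the line [w + h *: v] the argument of [f] is affine in [h], so the one-variable chain rule
    suffices. *)
Lemma is_derive_dotv_comp (f : R -> R) (u w v : 'cV[R]_d) :
  derivable f (dotv w u) 1 ->
  is_derive w v (fun w => f (dotv w u)) (dotv v u * f^`()%classic (dotv w u)).
Proof.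
move=> df; have df0 : derivable f (dotv w u + 0 * dotv v u) 1.
  by rewrite mul0r addr0.
have lineE : (fun h : R => f (dotv (h *: v + w) u)) =
             (fun h => f (dotv w u + h * dotv v u)).
  by apply/funext => h; rewrite dotvDl dotvZl addrC.
have [dg dE] := is_derive_affine_comp df0.
apply: DeriveDef; first by apply/derivable1P; rewrite lineE.
rewrite mul0r addr0 in dE; rewrite -dE /derive.
apply: (congr1 (fun g : R -> R => lim (g @ 0^')%classic)).
apply/funext => h /=.
by rewrite dotvDl dotvZl addr0 mul0r addr0 [_%:A]mulr1 (addrC (h * _)).
Qed.

Lemma is_derive_dotv (u w v : 'cV[R]_d) :
  is_derive w v (fun w => dotv w u) (dotv v u).
Proof.
have := @is_derive_dotv_comp id u w v (@derivable_id _ _ _ _).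
by rewrite derive1E derive_id mulr1.
Qed.

Lemma is_derive_sqr_norm2 (w v : 'cV[R]_d) :
  is_derive w v (fun w => norm2 w ^+ 2) (2 * dotv v w).
Proof.
have -> : (fun w : 'cV[R]_d => norm2 w ^+ 2) =
          \sum_(j < d) (fun w => dotv w (evec R j)) ^+ 2.
  apply/funext => u; rewrite sqr_norm2 fct_sumE; apply: eq_bigr => j _.
  by rewrite fctE dotv_evec expr2.
apply: is_derive_eq.
  by apply: is_derive_sum => j; apply: is_deriveX; exact: is_derive_dotv.
rewrite /= /dotv mulr_sumr; apply: eq_bigr => j _.
by rewrite -!/(dotv _ _) !dotv_evec expr1 [_ *: _]mulrAC mulrA.
Qed.

Definition Lgrad (m : nat) (w : 'cV[R]_d) : 'cV[R]_d :=
  \sum_(i < m) dl l (y i) (dotv w (x i)) *: x i + (lam * m%:R) *: w.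

(* The Hessian applied to the direction [v], see [hess_Lemp_mul]. *)
Definition Lhess_mul (m : nat) (w v : 'cV[R]_d) : 'cV[R]_d :=
  \sum_(i < m) (d2l l (y i) (dotv w (x i)) * dotv v (x i)) *: x i +
  (lam * m%:R) *: v.

Lemma is_derive_Lemp m (w v : 'cV[R]_d) :
  is_derive w v (Lemp l lam x y m) (dotv (Lgrad m w) v).
Proof.
have dh (i : 'I_m) :=
  @is_derive_dotv_comp (fun t => l t (y i)) (x i) w v (@dl1 _ _).
have -> : Lemp l lam x y m =
    \sum_(i < m) (fun u => l (dotv u (x i)) (y i)) +
    (lam * m%:R / 2) \*: (fun u => norm2 u ^+ 2).
  by apply/funext => u; rewrite fctE fct_sumE.
apply: is_derive_eq.
  apply: is_deriveD; last by apply: is_deriveZ; exact: is_derive_sqr_norm2.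
rewrite dotvDl dotv_suml dotvZl; congr (_ + _).
  by apply: eq_bigr => i _; rewrite dotvZl mulrC (dotvC v).
by rewrite [_ *: _]mulrA divfK// dotvC.
Qed.

Lemma grad_Lemp m : grad (Lemp l lam x y m) = Lgrad m.
Proof.
apply/funext => w; apply/colP => j; rewrite mxE.
by have [_ ->] := is_derive_Lemp m w (evec R j); rewrite dotv_evec.
Qed.

(** Pairing with [u] keeps the function scalar: [u = evec R j] yields the Hessian entries, and [u]
    equal to the Taylor remainder serves the mean value theorem. *)
Lemma is_derive_Lgrad m (w v u : 'cV[R]_d) :
  is_derive w v (fun w => dotv (Lgrad m w) u) (dotv (Lhess_mul m w v) u).
Proof.
have dh (i : 'I_m) := @is_derive_dotv_comp (dl l (y i)) (x i) w v (@dl2 _ _).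
have -> : (fun w => dotv (Lgrad m w) u) =
    \sum_(i < m) (dotv (x i) u \*: fun w => dl l (y i) (dotv w (x i))) +
    (lam * m%:R) \*: (fun w => dotv w u).
  apply/funext => z; rewrite fctE fct_sumE dotvDl dotv_suml dotvZl.
  by congr (_ + _); apply: eq_bigr => i _; rewrite dotvZl mulrC.
apply: is_derive_eq.
  apply: is_deriveD; last by apply: is_deriveZ; exact: is_derive_dotv.
rewrite dotvDl dotv_suml dotvZl; congr (_ + _).
by apply: eq_bigr => i _; rewrite dotvZl [_ *: _]mulrC (mulrC (d2l _ _ _)).
Qed.

Lemma hess_Lemp_mul m (w v : 'cV[R]_d) :
  hess (Lemp l lam x y m) w *m v = Lhess_mul m w v.
Proof.
apply/colP => j; rewrite mxE.
transitivity (\sum_k v k 0 * dotv (Lhess_mul m w (evec R k)) (evec R j)).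
  apply: eq_bigr => k _; rewrite mxE grad_Lemp mulrC; congr (_ * _).
  have -> : (fun u => Lgrad m u j 0) = (fun u => dotv (Lgrad m u) (evec R j)).
    by apply/funext => u; rewrite dotv_evec.
  by have [_ ->] := is_derive_Lgrad m w (evec R k) (evec R j).
rewrite -dotv_evec dotvDl dotv_suml.
under eq_bigr => k _ do rewrite dotvDl dotv_suml mulrDr mulr_sumr.
rewrite big_split exchange_big /=; congr (_ + _).
  apply: eq_bigr => i _; rewrite dotvZl dotv_evec [dotv v (x i)]/dotv.
  rewrite mulr_sumr mulr_suml.
  apply: eq_bigr => k _.
  by rewrite dotvZl (dotvC (evec R k)) !dotv_evec; ring.
rewrite dotvZl dotv_evec (bigD1 j)//= big1 ?addr0 => [|k /negPf kj].
  by rewrite dotvZl dotv_evec !mxE !eqxx mulr1 mulrC.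
by rewrite dotvZl dotv_evec !mxE eq_sym kj !mulr0.
Qed.

(** * Stationarity of the minimiser and coercivity of the Hessian *)

Lemma Lgrad_argmin m (w : 'cV[R]_d) :
  (forall u, Lemp l lam x y m w <= Lemp l lam x y m u) -> Lgrad m w = 0.
Proof.
move=> wmin; apply: norm2_eq0; apply/eqP; rewrite -sqrf_eq0 sqr_norm2; apply/eqP.
(* Along the gradient itself, the directional derivative at [w] is the squared norm of the gradient;
   it vanishes at a minimum. *)
set v := Lgrad _ _.
have dL t := is_derive_line (is_derive_Lemp m (w + t *: v) v).
have [_] := dL 0; rewrite scale0r addr0 => <-.
have [] // := @derive1_at_min _ (fun s => Lemp l lam x y m (w + s *: v)) (-1) 1 0.
- by rewrite in_itv/= ltrN10 ltr01.
- by move=> t _; rewrite scale0r addr0.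
Qed.

(** Each loss term contributes [d2l] times the square of [dotv v (x i)], so only the regulariser
    remains in the lower bound. *)
Lemma Lhess_mul_coercive m (w v : 'cV[R]_d) :
  (forall yy z, 0 <= d2l l yy z) ->
  lam * m%:R * norm2 v ^+ 2 <= dotv (Lhess_mul m w v) v.
Proof.
move=> d2l_ge0; rewrite sqr_norm2 dotvDl dotvZl lerDr dotv_suml sumr_ge0// => i _.
by rewrite dotvZl (dotvC (x i)) -mulrA -expr2 mulr_ge0// sqr_ge0.
Qed.

Lemma hess_Lemp_unitmx m (w : 'cV[R]_d) :
  (forall yy z, 0 <= d2l l yy z) -> 0 < lam -> (0 < m)%N ->
  hess (Lemp l lam x y m) w \in unitmx.
Proof.
(* [inj_row_free] concerns row vectors acting from the left, hence the transpose; coercivity makes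
   the kernel trivial. *)
move=> d2l_ge0 lam0 m0; rewrite -unitmx_tr -row_free_unit.
apply: inj_row_free => u uH0.
have Hu0 : Lhess_mul m w u^T = 0.
  by rewrite -hess_Lemp_mul//; apply: trmx_inj; rewrite trmx_mul trmxK uH0 trmx0.
have := Lhess_mul_coercive m w u^T d2l_ge0; rewrite Hu0 dotv0l.
rewrite pmulr_rle0 ?mulr_gt0 ?ltr0n// => n0; apply: trmx_inj; rewrite trmx0.
by apply: norm2_eq0; apply/eqP; rewrite -sqrf_eq0 eq_le n0 sqr_ge0.
Qed.

Lemma Lhess_mul_norm2 m (w v : 'cV[R]_d) :
  (forall yy z, 0 <= d2l l yy z) ->
  lam * m%:R * norm2 v <= norm2 (Lhess_mul m w v).
Proof.
move=> d2l_ge0; have [->|v0] := eqVneq (norm2 v) 0; first by rewrite mulr0 norm2_ge0.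
have {v0} v0 : 0 < norm2 v by rewrite lt0r v0 norm2_ge0.
rewrite -(ler_pM2r v0).
apply: (@le_trans _ _ (lam * m%:R * norm2 v ^+ 2)); first by rewrite expr2 mulrA.
apply: le_trans (Lhess_mul_coercive m w v d2l_ge0) _.
exact: le_trans (ler_norm _) (dotv_le_norm2 _ _).
Qed.

(** * Lipschitz Hessian and the Taylor remainder of the gradient *)

Lemma Lhess_mulB m (w w' v : 'cV[R]_d) :
  Lhess_mul m w v - Lhess_mul m w' v =
  \sum_(i < m) ((d2l l (y i) (dotv w (x i)) - d2l l (y i) (dotv w' (x i)))
                 * dotv v (x i)) *: x i.
Proof.
have addrK' (V : zmodType) (a b c : V) : a + c - (b + c) = a - b.
  by rewrite (addrC b) addrKA.
apply: (etrans (addrK' _ _ _ _)).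
rewrite -sumrB.
by apply: eq_bigr => i _; rewrite -scalerBl -mulrBl.
Qed.

(** One factor [norm2 v] comes from the shift [(s - t) * dotv v (x i)] of the argument of [d2l], the
    other from applying the Hessian to [v]. *)
Lemma Lhess_mul_lipschitz m gam (w v : 'cV[R]_d) s t :
  (forall yy a b, `|d2l l yy a - d2l l yy b| <= gam * `|a - b|) ->
  (forall i, (i < m)%N -> norm2 (x i) <= 1) ->
  norm2 (Lhess_mul m (w + s *: v) v - Lhess_mul m (w + t *: v) v)
    <= gam * m%:R * norm2 v ^+ 2 * `|s - t|.
Proof.
move=> lip x1; rewrite Lhess_mulB.
apply: le_trans (norm2_sum _) _.
rewrite (_ : gam * _ * _ * _ = \sum_(i < m) gam * norm2 v ^+ 2 * `|s - t|).
  apply: ler_sum => i _; rewrite norm2Z normrM.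
  have gam0 : 0 <= gam.
    by have := le_trans (normr_ge0 _) (lip (y i) 1 0); rewrite subr0 normr1 mulr1.
  have vx : `|dotv v (x i)| <= norm2 v.
    by rewrite (le_trans (dotv_le_norm2 _ _))// ler_piMr ?norm2_ge0 ?x1.
  have := lip (y i) (dotv (w + s *: v) (x i)) (dotv (w + t *: v) (x i)).
  have -> : dotv (w + s *: v) (x i) - dotv (w + t *: v) (x i) = (s - t) * dotv v (x i).
    by rewrite !dotvDl !dotvZl; ring.
  rewrite normrM => dv.
  apply: (@le_trans _ _ (gam * (`|s - t| * norm2 v) * norm2 v)); last first.
    by rewrite le_eqVlt; apply/orP; left; apply/eqP; ring.
  rewrite -[leRHS]mulr1 ler_pM ?norm2_ge0 ?mulr_ge0 ?normr_ge0 ?x1//.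
  rewrite ler_pM ?normr_ge0// (le_trans dv)// ler_wpM2l// ler_wpM2l//.
by rewrite sumr_const card_ord -[in RHS]mulr_natl; ring.
Qed.

Lemma Lgrad_taylor_le m (w v : 'cV[R]_d) :
  exists2 xi : R, 0 <= xi <= 1 &
    norm2 (Lgrad m (w + v) - Lgrad m w - Lhess_mul m w v)
    <= norm2 (Lhess_mul m (w + xi *: v) v - Lhess_mul m w v).
Proof.
set G := Lgrad m (w + v) - _ - _.
have dphi t := is_derive_line (is_derive_Lgrad m (w + t *: v) v G).
have [|xi] :=
    @MVT_segment _ (fun s => dotv (Lgrad m (w + s *: v)) G) _ 0 1 ler01.
  apply: continuous_subspaceT => t.
  by apply/differentiable_continuous/derivable1_diffP; case: (dphi t).
rewrite in_itv/= => xi01 phiE; exists xi => //.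
move: phiE; rewrite subr0 mulr1 scale1r scale0r addr0 -dotvBl => phiE.
have [->|G0] := eqVneq (norm2 G) 0; first exact: norm2_ge0.
have {}G0 : 0 < norm2 G by rewrite lt0r G0 norm2_ge0.
(* The mean value identity turns [dotv G G] into the pairing of the Hessian difference with [G];
   Cauchy-Schwarz then leaves one factor [norm2 G] to cancel. *)
rewrite -(ler_pM2r G0) -[leLHS]expr2 sqr_norm2 {1}/G dotvBl phiE -dotvBl.
exact: le_trans (ler_norm _) (dotv_le_norm2 _ _).
Qed.

Lemma Lgrad_taylor m gam (w v : 'cV[R]_d) :
  (forall yy a b, `|d2l l yy a - d2l l yy b| <= gam * `|a - b|) ->
  (forall i, (i < m)%N -> norm2 (x i) <= 1) ->
  exists2 eta : R, 0 <= eta <= 1 &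
    norm2 (Lgrad m (w + v) - Lgrad m w - Lhess_mul m w v)
    = norm2 (Lhess_mul m (w + eta *: v) v - Lhess_mul m w v).
Proof.
move=> lip x1; set E := norm2 (Lgrad _ _ - _ - _).
have [xi /andP[xi0 xi1] le_xi] := Lgrad_taylor_le m w v.
pose F t := norm2 (Lhess_mul m (w + t *: v) v - Lhess_mul m w v).
have F0 : F 0 = 0 by rewrite /F scale0r addr0 subrr norm2_0.
have Fcont : continuous F.
  apply: (@lipschitz_continuous _ _ (gam * m%:R * norm2 v ^+ 2)) => s t.
  apply: le_trans (norm2_dist _ _) _; rewrite opprB addrA subrK.
  exact: Lhess_mul_lipschitz.
(* The value [E] lies between [F 0 = 0] and [F xi]. *)
have [||eta] := @IVT R F 0 xi E xi0.
- exact: continuous_subspaceT.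
- rewrite F0 ge_min le_max norm2_ge0 /=; apply/orP; right; exact: le_xi.
rewrite in_itv/= => /andP[eta0 eta1] <-.
by exists eta; rewrite // eta0 (le_trans eta1 xi1).
Qed.

Lemma grad_loss i (w : 'cV[R]_d) :
  grad (fun u => l (dotv u (x i)) (y i)) w = dl l (y i) (dotv w (x i)) *: x i.
Proof.
apply/colP => j; rewrite !mxE.
have [_ ->] :=
  @is_derive_dotv_comp (fun t => l t (y i)) (x i) w (evec R j) (@dl1 _ _).
by rewrite dotvC dotv_evec mulrC.
Qed.

(** Stationarity equates [m%:R * lam *: w] with minus a sum of [m] loss gradients, of norm at most
    [m%:R * C]; dividing by [m] gives the bound. *)
Lemma argmin_norm2_le m C (w : 'cV[R]_d) :
  0 < lam -> (0 < m)%N -> Lgrad m w = 0 ->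
  (forall i, (i < m)%N -> norm2 (dl l (y i) (dotv w (x i)) *: x i) <= C) ->
  norm2 (lam *: w) <= C.
Proof.
move=> lam0 m0; rewrite /Lgrad => /eqP; rewrite addrC addr_eq0 => /eqP Lw gC.
have m0' : 0 < m%:R :> R by rewrite ltr0n.
rewrite -(ler_pM2l m0') -[X in X * _](gtr0_norm m0') -norm2Z scalerA mulrC Lw norm2N.
apply: le_trans (norm2_sum _) _.
apply: (@le_trans _ _ (\sum_(i < m) C)); first by apply: ler_sum => i _; exact: gC.
by rewrite sumr_const card_ord mulr_natl.
Qed.

End Ridge.

(* Data D = {(x 0, y 0), ..., (x (n-1), y (n-1))}; the removed point is index n-1;
   D' = first n-1 points. *)
Theorem theorem1 (R : realType) (d n : nat) (Y : Type)
  (x : nat -> 'cV[R]_d) (y : nat -> Y) (l : R -> Y -> R)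
  (lam C gam : R) (wstar : 'cV[R]_d) :
  (2 <= n)%N ->
  0 < lam ->
  (* convex in its first argument *)
  (forall (yy : Y) (a b t : R), 0 <= t <= 1 ->
     l (t * a + (1 - t) * b) yy <= t * l a yy + (1 - t) * l b yy) ->
  (* twice differentiable in its first argument *)
  (forall (yy : Y) (z : R), derivable (fun t => l t yy) z 1) ->
  (forall (yy : Y) (z : R), derivable (dl l yy) z 1) ->
  (* wstar = argmin_w L(w; D) *)
  (forall w : 'cV[R]_d, Lemp l lam x y n wstar <= Lemp l lam x y n w) ->
  (* bounded gradients *)
  (forall (i : nat) (w : 'cV[R]_d), (i < n)%N ->
     norm2 (grad (fun u => l (dotv u (x i)) (y i)) w) <= C) ->
  (* l'' is gam-Lipschitz *)
  (forall (yy : Y) (a b : R), `|d2l l yy a - d2l l yy b| <= gam * `|a - b|) ->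
  (forall i : nat, (i < n)%N -> norm2 (x i) <= 1) ->
  let L' := Lemp l lam x y n.-1 in
  let H := hess L' in
  let Delta := lam *: wstar + grad (fun u => l (dotv u (x n.-1)) (y n.-1)) wstar in
  let v := invmx (H wstar) *m Delta in
  let wminus := wstar + v in
  exists eta : R, 0 <= eta <= 1 /\
    let weta := wstar + eta *: v in
    norm2 (grad L' wminus) = norm2 ((H weta - H wstar) *m v) /\
    norm2 ((H weta - H wstar) *m v) <= gam * n.-1%:R * norm2 v ^+ 2 /\
    gam * n.-1%:R * norm2 v ^+ 2 <= 4 * gam * C ^+ 2 / (lam ^+ 2 * n.-1%:R).
Proof.
(* Writing [n = m.+1] turns [n.-1] into [m], which is positive because [2 <= n]. *)
case: n => [//|m]; rewrite ltnS [m.+1.-1]/= => m0.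
move=> lam0 cvx dl1 dl2 wmin gC lip x1 L' H Delta v wminus.
have d2l_ge0 yy z : 0 <= d2l l yy z.
  by apply: convex_derive2_ge0 (dl2 yy z) => // a b s; exact: cvx.
have gam0 : 0 <= gam.
  by have := le_trans (normr_ge0 _) (lip (y 0) 1 0); rewrite subr0 normr1 mulr1.
have x1' i : (i < m)%N -> norm2 (x i) <= 1 by move=> im; exact/x1/ltnW.
have w0 := Lgrad_argmin dl1 wmin.
(* Splitting off the last loss and one [lam *: wstar] from the zero gradient on all [m.+1] points
   leaves exactly [Delta]. *)
have DeltaE : Lgrad l lam x y m wstar = - Delta.
  apply/eqP; rewrite -addr_eq0 -[X in _ == X]w0 /Delta (grad_loss x y dl1).
  rewrite {2}/Lgrad big_ord_recr/= -natr1 mulrDr mulr1 scalerDl.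
  by apply/eqP; rewrite [RHS]addrACA; congr (_ + _); exact: addrC.
have Hv : Lhess_mul l lam x y m wstar v = Delta.
  by rewrite -hess_Lemp_mul// mulKVmx// hess_Lemp_unitmx.
have [eta /andP[eta0 eta1] etaE] := Lgrad_taylor lam y dl2 wstar v lip x1'.
(* In [2 * C], one [C] bounds [lam *: wstar] and the other the gradient at the removed point. *)
have v_le : norm2 v <= 2 * C / (lam * m%:R).
  rewrite ler_pdivlMr ?mulr_gt0 ?ltr0n// mulrC.
  apply: le_trans (Lhess_mul_norm2 lam x y m wstar v d2l_ge0) _.
  rewrite Hv; apply: le_trans (norm2D _ _) _; rewrite mulr_natl mulr2n lerD ?gC//.
  by apply: argmin_norm2_le w0 _ => // i im; rewrite -(grad_loss x y dl1) gC.
have HvE : (H (wstar + eta *: v) - H wstar) *m v =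
    Lhess_mul l lam x y m (wstar + eta *: v) v - Lhess_mul l lam x y m wstar v.
  by rewrite mulmxBl -!(hess_Lemp_mul lam x y dl1 dl2).
exists eta; split; first by rewrite eta0.
cbv zeta; rewrite HvE (grad_Lemp lam x y dl1); split; [|split].
(* The zeroth and first order Taylor terms, [- Delta] and [Delta], cancel. *)
- by rewrite -etaE Hv DeltaE opprK addrK.
(* Comparing the parameters [eta] and 0 yields an extra factor [eta], which is at most 1. *)
- have := Lhess_mul_lipschitz lam y wstar v eta 0 lip x1'.
  rewrite scale0r addr0 subr0 ger0_norm// => /le_trans -> //.
  by rewrite ler_piMr// mulr_ge0 ?sqr_ge0// mulr_ge0.
- have m0' : 0 < m%:R :> R by rewrite ltr0n.
  have -> : 4 * gam * C ^+ 2 / (lam ^+ 2 * m%:R) =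
            gam * m%:R * (2 * C / (lam * m%:R)) ^+ 2.
    by field; rewrite !gt_eqF.
  rewrite ler_wpM2l ?mulr_ge0// lerXn2r ?nnegrE ?norm2_ge0//.
  exact: le_trans (norm2_ge0 v) v_le.
Qed.
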